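(* Let $A\in\mathbb{R}^{n_x\times n_x}$, $B\in\mathbb{R}^{n_x\times n_u}$ with $(A,B)$ stabilizable, and let $H=\begin{bmatrix}Q&S^\top\\ S&R\end{bmatrix}$ be real symmetric. Consider the two conditions: (I) there exist symmetric matrices $\Lambda_1,\Lambda_2$ with $H_{\Lambda_1}\succeq0$, $H_{\Lambda_2}\succeq0$ and $\Lambda_1-\Lambda_2\succ0$; (II) there exists a symmetric matrix $\Lambda$ with $H_\Lambda\succeq0$ and $Q_\Lambda-S_\Lambda^\top R_\Lambda^\dagger S_\Lambda\succ0$. Then (I) and (II) imply each other. If either of them holds, then the CGDARE has a symmetric solution $P$ for which, with $K=R_P^\dagger S_P$ and $G=I-R_P^\dagger R_P$, the closed-loop system $x_+=(A-BK)x+BGv$, $v$ arbitrary, is exponentially stable and $BG=0$. Moreover, (I) and (II) are also necessary for exponential stability: if the CGDARE has a symmetric solution $P$ with $R_P\succeq0$ whose associated closed-loop system $x_+=(A-BK)x+BGv$, $v$ arbitrary, is exponentially stable, then (I) and (II) hold.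
   Context: For symmetric $M\in\mathbb{R}^{n_x\times n_x}$ define $Q_M:=Q+A^\top MA-M$, $S_M:=S+B^\top MA$, $R_M:=R+B^\top MB$, $H_M:=\begin{bmatrix}Q_M&S_M^\top\\ S_M&R_M\end{bmatrix}$. $\dagger$ denotes the Moore-Penrose pseudo-inverse. The CGDARE (constrained generalized discrete algebraic Riccati equation) in the symmetric unknown $P$ is: $0=Q_P-S_P^\top K$, $K=R_P^\dagger S_P$, $\ker(R_P)\subseteq\ker(S_P^\top)$. The closed-loop system $x_+=(A-BK)x+BGv$ with $v$ arbitrary is exponentially stable if there are $c>0$ and $\rho\in(0,1)$ such that $\|x_k\|\le c\rho^k\|x_0\|$ for all $k\ge 0$, all $x_0$ and every sequence of vectors $(v_k)$. It describes the state evolution under all the optimal feedbacks $u=-Kx+Gv$ of the infinite-horizon linear-quadratic optimal control problem with dynamics $x_{k+1}=Ax_k+Bu_k$ and stage cost $\begin{bmatrix}x\\ u\end{bmatrix}^\top H\begin{bmatrix}x\\ u\end{bmatrix}$. *)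

(* Defs.v *)
From HB Require Import structures.
From mathcomp Require Import all_boot all_order all_algebra.
From mathcomp Require Import reals.

Set Implicit Arguments.
Unset Strict Implicit.
Unset Printing Implicit Defensive.

Import Order.TTheory GRing.Theory Num.Theory.

Local Open Scope ring_scope.

(* The four Penrose equations, for real matrices. *)
Definition is_mpinv (F : realFieldType) (m n : nat)
    (M : 'M[F]_(m, n)) (X : 'M[F]_(n, m)) : Prop :=
  [/\ M *m X *m M = M, X *m M *m X = X,
      (M *m X)^T = M *m X & (X *m M)^T = X *m M].

(* With the full-rank factorization M = C *m L (C with independent columns,
   L with independent rows), the Moore-Penrose pseudo-inverse of M is
   L^T (L L^T)^-1 (C^T C)^-1 C^T; [mpinvP] characterizes it as the unique
   solution of the Penrose equations. Note that mathcomp's [pinvmx] is only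
   a generalized inverse and differs from it. *)
Definition mpinv (F : realFieldType) (m n : nat) (M : 'M[F]_(m, n)) :
    'M[F]_(n, m) :=
  let C := col_base M in
  let L := row_base M in
  L^T *m invmx (L *m L^T) *m (invmx (C^T *m C) *m C^T).

Lemma gram_unitmx (F : realFieldType) (m n : nat) (L : 'M[F]_(m, n)) :
  row_free L -> L *m L^T \in unitmx.
Proof.
move=> Lfree; rewrite -row_free_unit -kermx_eq0; apply/eqP/row_matrixP=> i.
rewrite row0; set v := row i _.
have vL0 : v *m (L *m L^T) = 0 by apply: sub_kermxP; apply: row_sub.
suff : v *m L = 0 by move=> vL; apply: (row_free_inj Lfree); rewrite mul0mx.
have : (v *m L *m (v *m L)^T) 0 0 = 0.
  by rewrite trmx_mul mulmxA -(mulmxA v) vL0 mul0mx mxE.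
rewrite mxE; set w := v *m L => /eqP; rewrite psumr_eq0; last first.
  by move=> j _; rewrite [w^T _ _]mxE -expr2 sqr_ge0.
move=> /allP w0; apply/rowP=> j; rewrite [RHS]mxE.
have := w0 j (mem_index_enum _).
by rewrite /= [w^T _ _]mxE -expr2 sqrf_eq0 => /eqP.
Qed.

Lemma is_mpinv_uniq (F : realFieldType) (m n : nat) (M : 'M[F]_(m, n))
  (X Y : 'M[F]_(n, m)) : is_mpinv M X -> is_mpinv M Y -> X = Y.
Proof.
case=> MXM XMX sMX sXM [MYM YMY sMY sYM].
have eMX : M *m X = M *m Y.
  rewrite -sMX -{1}MYM -(mulmxA (M *m Y)) trmx_mul sMX sMY.
  by rewrite mulmxA MXM.
have eXM : X *m M = Y *m M.
  rewrite -sXM -{1}MYM -(mulmxA M) mulmxA trmx_mul sYM sXM.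
  by rewrite -!mulmxA (mulmxA M) MXM.
by rewrite -XMX eXM -mulmxA eMX mulmxA YMY.
Qed.

Lemma mpinvP (F : realFieldType) (m n : nat) (M : 'M[F]_(m, n))
  (X : 'M[F]_(n, m)) : is_mpinv M X <-> X = mpinv M.
Proof.
suff MM : is_mpinv M (mpinv M).
  by split=> [/is_mpinv_uniq|->//]; apply.
rewrite /mpinv; set C := col_base M; set L := row_base M.
have uL : L *m L^T \in unitmx by apply/gram_unitmx/row_base_free.
have uC : C^T *m C \in unitmx.
  rewrite -{2}[C]trmxK; apply: gram_unitmx.
  by rewrite /row_free mxrank_tr; apply: col_base_full.
have sL : (invmx (L *m L^T))^T = invmx (L *m L^T).
  by rewrite trmx_inv trmx_mul trmxK.
have sC : (invmx (C^T *m C))^T = invmx (C^T *m C).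
  by rewrite trmx_inv trmx_mul trmxK.
have MCL : M = C *m L by rewrite mulmx_base.
move: C L uL uC sL sC MCL => {}C {}L uL uC sL sC MCL.
set U := _ *m invmx _; set V := invmx _ *m _.
have LU : L *m U = 1%:M by rewrite mulmxA mulmxV.
have VC : V *m C = 1%:M by rewrite -mulmxA mulVmx.
have MX : M *m (U *m V) = C *m V.
  by rewrite [X in X *m _]MCL -mulmxA (mulmxA L) LU mul1mx.
have XM : U *m V *m M = U *m L.
  by rewrite [X in _ *m X]MCL mulmxA -(mulmxA U) VC mulmx1.
split; rewrite ?MX ?XM.
- by rewrite [X in _ *m X]MCL mulmxA -(mulmxA C) VC mulmx1.
- by rewrite mulmxA -(mulmxA U L) LU mulmx1.
- by rewrite /V !trmx_mul sC trmxK mulmxA.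
- by rewrite /U !trmx_mul sL trmxK mulmxA.
Qed.

Definition sym_mx (F : realFieldType) (n : nat) (M : 'M[F]_n) : Prop :=
  M^T = M.

Definition psd_mx (F : realFieldType) (n : nat) (M : 'M[F]_n) : Prop :=
  sym_mx M /\ forall x : 'cV[F]_n, 0 <= (x^T *m M *m x) 0 0.

Definition pd_mx (F : realFieldType) (n : nat) (M : 'M[F]_n) : Prop :=
  sym_mx M /\ forall x : 'cV[F]_n, x != 0 -> 0 < (x^T *m M *m x) 0 0.

Definition enorm (R : realType) (n : nat) (x : 'cV[R]_n) : R :=
  Num.sqrt (\sum_i x i 0 ^+ 2).

(* Exponential stability of x_+ = M x + N v, uniformly in the arbitrary
   sequence v. *)
Definition exp_stable (R : realType) (n m : nat)
    (M : 'M[R]_n) (N : 'M[R]_(n, m)) : Prop :=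
  exists c rho : R, [/\ 0 < c, 0 < rho, rho < 1 &
    forall (x : nat -> 'cV[R]_n) (v : nat -> 'cV[R]_m),
      (forall k, x k.+1 = M *m x k + N *m v k) ->
      forall k, enorm (x k) <= c * rho ^+ k * enorm (x 0%N)].

(* Some state feedback u = - F x renders x_+ = (A - B F) x exponentially
   stable (no exogenous input: the second matrix is zero). *)
Definition stabilizable (R : realType) (nx nu : nat)
    (A : 'M[R]_nx) (B : 'M[R]_(nx, nu)) : Prop :=
  exists F : 'M[R]_(nu, nx), exp_stable (A - B *m F) (0 : 'M[R]_(nx, nu)).

Definition Qof (F : realFieldType) (nx : nat) (A Q M : 'M[F]_nx) : 'M[F]_nx :=
  Q + A^T *m M *m A - M.

Definition Sof (F : realFieldType) (nx nu : nat) (A : 'M[F]_nx)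
    (B : 'M[F]_(nx, nu)) (S : 'M[F]_(nu, nx)) (M : 'M[F]_nx) :
    'M[F]_(nu, nx) :=
  S + B^T *m M *m A.

Definition Rof (F : realFieldType) (nx nu : nat) (B : 'M[F]_(nx, nu))
    (R : 'M[F]_nu) (M : 'M[F]_nx) : 'M[F]_nu :=
  R + B^T *m M *m B.

Definition Hof (F : realFieldType) (nx nu : nat) (A : 'M[F]_nx)
    (B : 'M[F]_(nx, nu)) (Q : 'M[F]_nx) (S : 'M[F]_(nu, nx)) (R : 'M[F]_nu)
    (M : 'M[F]_nx) : 'M[F]_(nx + nu) :=
  block_mx (Qof A Q M) (Sof A B S M)^T (Sof A B S M) (Rof B R M).

Definition Kof (F : realFieldType) (nx nu : nat) (A : 'M[F]_nx)
    (B : 'M[F]_(nx, nu)) (S : 'M[F]_(nu, nx)) (R : 'M[F]_nu) (P : 'M[F]_nx) :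
    'M[F]_(nu, nx) :=
  mpinv (Rof B R P) *m Sof A B S P.

Definition Gof (F : realFieldType) (nx nu : nat) (B : 'M[F]_(nx, nu))
    (R : 'M[F]_nu) (P : 'M[F]_nx) : 'M[F]_nu :=
  1%:M - mpinv (Rof B R P) *m Rof B R P.

(* P is a symmetric solution of the constrained generalized discrete
   algebraic Riccati equation. *)
Definition CGDARE (F : realFieldType) (nx nu : nat) (A : 'M[F]_nx)
    (B : 'M[F]_(nx, nu)) (Q : 'M[F]_nx) (S : 'M[F]_(nu, nx)) (R : 'M[F]_nu)
    (P : 'M[F]_nx) : Prop :=
  [/\ sym_mx P,
      0 = Qof A Q P - (Sof A B S P)^T *m Kof A B S R P &
      forall u : 'cV[F]_nu, Rof B R P *m u = 0 -> (Sof A B S P)^T *m u = 0].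

Definition closed_loop_exp_stable (F : realType) (nx nu : nat) (A : 'M[F]_nx)
    (B : 'M[F]_(nx, nu)) (S : 'M[F]_(nu, nx)) (R : 'M[F]_nu) (P : 'M[F]_nx) :
    Prop :=
  exp_stable (A - B *m Kof A B S R P) (B *m Gof B R P).

Definition condI (F : realFieldType) (nx nu : nat) (A : 'M[F]_nx)
    (B : 'M[F]_(nx, nu)) (Q : 'M[F]_nx) (S : 'M[F]_(nu, nx)) (R : 'M[F]_nu) :
    Prop :=
  exists L1 L2 : 'M[F]_nx,
    [/\ sym_mx L1, sym_mx L2, psd_mx (Hof A B Q S R L1),
        psd_mx (Hof A B Q S R L2) & pd_mx (L1 - L2)].

Definition condII (F : realFieldType) (nx nu : nat) (A : 'M[F]_nx)
    (B : 'M[F]_(nx, nu)) (Q : 'M[F]_nx) (S : 'M[F]_(nu, nx)) (R : 'M[F]_nu) :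
    Prop :=
  exists L : 'M[F]_nx,
    [/\ sym_mx L, psd_mx (Hof A B Q S R L) &
        pd_mx (Qof A Q L
               - (Sof A B S L)^T *m mpinv (Rof B R L) *m Sof A B S L)].

(* Main.v *)
(** Write [h_M (x, u)] for the quadratic form of [H_M]; up to the fixed stage
    cost it is [M (A x + B u) - M x], so [H_M >= 0] makes the Riccati step
    [T M := M + schur M] monotone, with [schur M x = min_u h_M (x, u) >= 0].

    (II) => (I): take [T L] and [L].  (I) => (II): start value iteration at the
    midpoint [L] of the two certificates and let [D] be their difference.  If
    [T^N L x = L x], some trajectory from [x] has zero cost for both
    certificates, hence [D (x_(k+1), A y + B w) = D (x_k, y)] for all [y, w].
    Taking for [y] the trajectory of a stabilizing feedback from [x] gives
    [D (x_N, y_N) = D (x, x)] with [y_N] small and [D (x_N, x_N) = D (x, x)],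
    which forces [x = 0].  So [T^N L > L], and the average of
    [L, T L, ..., T^(N-1) L] satisfies (II), since [h_M] is affine in [M].

    Under (II) the iterates [T^k L] increase, are bounded by the cost of a
    stabilizing feedback, and converge to some [P].  Since [T L > L], the
    successor states reached by the minimizers stay bounded, so [schur P = 0].
    The Lyapunov function [P - L] then gives stability and [B G = 0].

    Conversely, for a stabilizing [P], [P - eps X] satisfies (II), where [X]
    solves a strict Lyapunov inequality for [A - B K]. *)
Require Import Defs.
From HB Require Import structures.
From mathcomp Require Import all_boot all_order all_algebra.
From mathcomp Require Import reals.
From mathcomp Require Import ring lra.
From mathcomp Require Import boolp classical_sets topology normedtype sequences.

Set Implicit Arguments.
Unset Strict Implicit.
Unset Printing Implicit Defensive.

Import Order.TTheory GRing.Theory Num.Theory.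
Import numFieldNormedType.Exports.

Local Open Scope classical_set_scope.
Local Open Scope ring_scope.

(** * Bilinear and quadratic forms of a matrix *)

Definition bil (F : realFieldType) n (M : 'M[F]_n) (x y : 'cV[F]_n) : F :=
  (x^T *m M *m y) 0 0.

Definition qf (F : realFieldType) n (M : 'M[F]_n) (x : 'cV[F]_n) : F :=
  bil M x x.

Section BilinearForms.
Variables (F : realFieldType) (n : nat).
Implicit Types (M N : 'M[F]_n) (x y z : 'cV[F]_n).

Lemma bilE M x y : bil M x y = \sum_i \sum_j x i 0 * M i j * y j 0.
Proof.
rewrite /bil -mulmxA mxE; apply: eq_bigr => i _.
rewrite !mxE mulr_sumr; apply: eq_bigr => j _; by rewrite mulrA.
Qed.

Lemma bilDl M x y z : bil M (x + y) z = bil M x z + bil M y z.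
Proof. by rewrite /bil linearD /= !mulmxDl mxE. Qed.

Lemma bilDr M x y z : bil M z (x + y) = bil M z x + bil M z y.
Proof. by rewrite /bil mulmxDr mxE. Qed.

Lemma bilZl M a x y : bil M (a *: x) y = a * bil M x y.
Proof. by rewrite /bil linearZ /= -!scalemxAl mxE. Qed.

Lemma bilZr M a x y : bil M x (a *: y) = a * bil M x y.
Proof. by rewrite /bil -!scalemxAr mxE. Qed.

Lemma bilC M x y : sym_mx M -> bil M x y = bil M y x.
Proof.
move=> sM; rewrite /bil.
have -> : y^T *m M *m x = (x^T *m M *m y)^T.
  by rewrite !trmx_mul trmxK sM mulmxA.
by rewrite [RHS]mxE.
Qed.

Lemma bil0l M y : bil M 0 y = 0.
Proof. by rewrite -(scale0r y) bilZl mul0r. Qed.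

Lemma bilD M N x y : bil (M + N) x y = bil M x y + bil N x y.
Proof. by rewrite /bil mulmxDr mulmxDl mxE. Qed.

Lemma bilB M N x y : bil (M - N) x y = bil M x y - bil N x y.
Proof. by rewrite /bil mulmxBr mulmxBl !mxE. Qed.

Lemma bilZ M a x y : bil (a *: M) x y = a * bil M x y.
Proof. by rewrite /bil -scalemxAr -scalemxAl mxE. Qed.

Lemma bil_sum (I : finType) (f : I -> 'M[F]_n) x y :
  bil (\sum_i f i) x y = \sum_i bil (f i) x y.
Proof. by rewrite /bil mulmx_sumr mulmx_suml summxE. Qed.

Lemma bil_congr m (X : 'M[F]_(n, m)) M (a b : 'cV[F]_m) :
  bil (X^T *m M *m X) a b = bil M (X *m a) (X *m b).
Proof. by rewrite /bil trmx_mul !mulmxA. Qed.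

Lemma qfD M x y : sym_mx M -> qf M (x + y) = qf M x + 2 * bil M x y + qf M y.
Proof.
by move=> sM; rewrite /qf bilDl !bilDr (bilC y x sM); ring.
Qed.

Lemma qf_subm M N x : qf (M - N) x = qf M x - qf N x.
Proof. exact: bilB. Qed.

Lemma qf_mx0 x : qf 0 x = 0.
Proof. by rewrite /qf /bil mulmx0 mul0mx mxE. Qed.

Lemma qfZ M a x : qf M (a *: x) = a ^+ 2 * qf M x.
Proof. by rewrite /qf bilZl bilZr mulrA. Qed.

Lemma qf1E x : qf 1%:M x = \sum_i x i 0 ^+ 2.
Proof.
rewrite /qf /bil mulmx1 mxE; apply: eq_bigr => i _.
by rewrite mxE expr2.
Qed.

Lemma qf1_ge0 x : 0 <= qf 1%:M x.
Proof. by rewrite qf1E sumr_ge0 // => i _; rewrite sqr_ge0. Qed.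

Lemma sqr_coord_le x i : x i 0 ^+ 2 <= qf 1%:M x.
Proof.
rewrite qf1E (bigD1 i) //= lerDl sumr_ge0 // => j _; exact: sqr_ge0.
Qed.

(** Cauchy-Schwarz for a semi-definite form: the polynomial [t -> qf M (x + t *: y)] is
    nonnegative. *)
Lemma psd_bil_sqr_le M x y : psd_mx M -> bil M x y ^+ 2 <= qf M x * qf M y.
Proof.
case=> sM pM.
have H t : 0 <= qf M x + 2 * t * bil M x y + t ^+ 2 * qf M y.
  have := pM (x + t *: y); rewrite -/(bil _ _ _) -/(qf _ _) qfD //.
  by rewrite bilZr qfZ mulrA.
have a0 : 0 <= qf M x := pM x.
have : 0 <= qf M y := pM y.
(* If [qf M y = 0], the polynomial is affine in [t], and a nonzero slope would let it reach -1.
   Otherwise it is evaluated at its minimizer. *)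
rewrite le_eqVlt => /orP[/eqP c0|cgt0].
  have [->|b0] := eqVneq (bil M x y) 0; first by rewrite expr0n -c0 mulr0.
  have := H (- (qf M x + 1) / (2 * bil M x y)).
  rewrite -c0 mulr0 addr0.
  suff -> : 2 * (- (qf M x + 1) / (2 * bil M x y)) * bil M x y
            = - (qf M x + 1) by lra.
  by field.
have := H (- bil M x y / qf M y).
set a := qf M x; set b := bil M x y; set c := qf M y in cgt0 *.
have -> : a + 2 * (- b / c) * b + (- b / c) ^+ 2 * c = (a * c - b ^+ 2) / c.
  by field; rewrite gt_eqF.
by rewrite pmulr_lge0 ?invr_gt0 // subr_ge0.
Qed.

Lemma psd_qf0_bil0 M x y : psd_mx M -> qf M x = 0 -> bil M x y = 0.
Proof.
move=> pM q0; have := psd_bil_sqr_le x y pM; rewrite q0 mul0r => b0.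
by apply/eqP; rewrite -sqrf_eq0 eq_le b0 sqr_ge0.
Qed.

Lemma bil_deltal M i x : bil M (delta_mx i 0) x = (M *m x) i 0.
Proof.
rewrite /bil -mulmxA mxE (bigD1 i) //= big1 ?addr0 => [|j ji].
  by rewrite !mxE !eqxx mul1r.
by rewrite !mxE (negbTE ji) mul0r.
Qed.

Lemma bil_delta M i j : bil M (delta_mx i 0) (delta_mx j 0) = M i j.
Proof. by rewrite bil_deltal -colE mxE. Qed.

(** Polarization; it lets entrywise limits be read off from limits of quadratic forms. *)
Lemma sym_entry M i j : sym_mx M ->
  M i j = (qf M (delta_mx i 0 + delta_mx j 0)
           - qf M (delta_mx i 0) - qf M (delta_mx j 0)) / 2.
Proof. by move=> sM; rewrite qfD // bil_delta; field. Qed.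

(** The constant is crude but explicit in the entries, so entrywise convergence bounds the forms
    uniformly in [x]. *)
Lemma qf_le_norm M x :
  qf M x <= (\sum_i \sum_j `|M i j|) * qf 1%:M x.
Proof.
rewrite /qf [leLHS]bilE mulr_suml; apply: ler_sum => i _.
rewrite mulr_suml; apply: ler_sum => j _.
rewrite mulrAC mulrC; apply: (le_trans (ler_norm _)).
rewrite normrM ler_wpM2l ?normr_ge0 // normrM.
have := sqr_coord_le x i; have := sqr_coord_le x j.
rewrite -(real_normK (num_real (x i 0))) -(real_normK (num_real (x j 0))).
have := sqr_ge0 (`|x i 0| - `|x j 0|); rewrite -/(qf _ _); nra.
Qed.

Lemma qf_ub M : exists2 C, 0 < C & forall x, qf M x <= C * qf 1%:M x.
Proof.
exists (1 + \sum_i \sum_j `|M i j|).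
  by rewrite ltr_pwDl // sumr_ge0 // => i _; rewrite sumr_ge0.
move=> x; apply: (le_trans (qf_le_norm M x)).
by rewrite ler_wpM2r ?qf1_ge0 // lerDr.
Qed.

Lemma pd_psd M : pd_mx M -> psd_mx M.
Proof.
case=> sM pM; split=> // x; have [->|/pM/ltW//] := eqVneq x 0.
by rewrite -/(bil _ _ _) bil0l.
Qed.

Lemma pd_unitmx M : pd_mx M -> M \in unitmx.
Proof.
case=> sM pM; rewrite -row_free_unit -kermx_eq0; apply/eqP/row_matrixP => i.
rewrite row0; set v := row i _.
have vM : v *m M = 0 by apply: sub_kermxP; apply: row_sub.
have [v0|vN0] := eqVneq v^T 0; first by rewrite -[v]trmxK v0 trmx0.
by have := pM _ vN0; rewrite trmxK vM mul0mx mxE ltxx.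
Qed.

(* Cauchy-Schwarz for [M] bounds each [x_i = x^T M (M^-1 e_i)]. *)
Lemma pd_lb M : pd_mx M ->
  exists2 e, 0 < e & forall x, e * qf 1%:M x <= qf M x.
Proof.
move=> pM; have psM := pd_psd pM; have uM := pd_unitmx pM.
pose t := \sum_i qf M (invmx M *m delta_mx i 0).
have t0 : 0 <= t by apply: sumr_ge0 => i _; exact: psM.2.
have t1 : 0 < 1 + t by rewrite ltr_pwDl.
exists (1 + t)^-1; first by rewrite invr_gt0.
move=> x; rewrite mulrC ler_pdivrMr //.
apply: (@le_trans _ _ (qf M x * t)); last first.
  by rewrite ler_wpM2l ?lerDr //; exact: psM.2.
rewrite qf1E mulr_sumr; apply: ler_sum => i _.
suff -> : x i 0 = bil M x (invmx M *m delta_mx i 0) by exact: psd_bil_sqr_le.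
rewrite /bil mulmxA mulmxK // -colE mxE.
by rewrite mxE.
Qed.

Lemma psd_qf0 M : psd_mx M -> (forall x, qf M x <= 0) -> M = 0.
Proof.
case=> sM pM M0; have q0 x : qf M x = 0.
  by apply/le_anti; rewrite M0 /=; exact: pM.
by apply/matrixP => i j; rewrite (sym_entry i j sM) !q0 !subr0 mul0r mxE.
Qed.

Lemma symD M N : sym_mx M -> sym_mx N -> sym_mx (M + N).
Proof. by rewrite /sym_mx linearD /= => -> ->. Qed.

Lemma symB M N : sym_mx M -> sym_mx N -> sym_mx (M - N).
Proof. by rewrite /sym_mx linearB /= => -> ->. Qed.

Lemma symZ a M : sym_mx M -> sym_mx (a *: M).
Proof. by rewrite /sym_mx linearZ /= => ->. Qed.

Lemma sym_sum (I : finType) (f : I -> 'M[F]_n) :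
  (forall i, sym_mx (f i)) -> sym_mx (\sum_i f i).
Proof. by rewrite /sym_mx linear_sum /= => sf; apply: eq_bigr. Qed.

End BilinearForms.

(** * Pseudo-inverses of symmetric matrices and completion of the square *)

Lemma sym_congr (F : realFieldType) n m (X : 'M[F]_(n, m)) (M : 'M[F]_n) :
  sym_mx M -> sym_mx (X^T *m M *m X).
Proof. by move=> sM; rewrite /sym_mx !trmx_mul trmxK sM mulmxA. Qed.

(** Transposing the Penrose equations of a symmetric [M] gives them back for the transpose of
    [mpinv M]; uniqueness concludes. *)
Lemma mpinv_sym (F : realFieldType) n (M : 'M[F]_n) :
  sym_mx M -> sym_mx (mpinv M).
Proof.
move=> sM; rewrite /sym_mx; apply/mpinvP.
have [] := (mpinvP M (mpinv M)).2 erefl.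
move: (mpinv M) => X MXM XMX sMX sXM.
have e1 : M *m X^T = X *m M by rewrite -[RHS]sXM trmx_mul sM.
have e2 : X^T *m M = M *m X by rewrite -[RHS]sMX trmx_mul sM.
split.
- by have := congr1 trmx MXM; rewrite !trmx_mul sM mulmxA.
- have := congr1 trmx XMX; rewrite !trmx_mul mulmxA => XMX'.
  by rewrite -[in RHS]XMX' sM.
- by rewrite e1.
- by rewrite e2.
Qed.

Lemma psd_mulmx0 (F : realFieldType) n (M : 'M[F]_n) (x : 'cV[F]_n) :
  psd_mx M -> qf M x = 0 -> M *m x = 0.
Proof.
move=> pM q0; apply/colP => i; rewrite -bil_deltal (bilC _ _ pM.1) mxE.
exact: psd_qf0_bil0.
Qed.

(** The columns of [1%:M - mpinv M *m M] lie in the kernel of [M], hence in that of [N]. *)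
Lemma mpinv_ker (F : realFieldType) m n (M : 'M[F]_n) (N : 'M[F]_(m, n)) :
  (forall u : 'cV[F]_n, M *m u = 0 -> N *m u = 0) ->
  N *m (mpinv M *m M) = N.
Proof.
move=> kMN; have [MXM _ _ _] := (mpinvP M (mpinv M)).2 erefl.
apply/eqP; rewrite -subr_eq0 -{2}[N]mulmx1 -mulmxBr; apply/eqP.
apply/matrixP => i j; set X := _ - _.
have : N *m col j X = 0.
  by apply: kMN; rewrite colE mulmxA mulmxBr mulmxA MXM mulmx1 subrr mul0mx.
by rewrite colE mulmxA -colE => /matrixP/(_ i 0); rewrite !mxE.
Qed.

(** Congruence by a unit lower triangular block matrix. The kernel condition supplies
    [Rm *m K = Sm], which replaces invertibility of [Rm]. *)
Lemma complete_square (F : realFieldType) n m (Qm : 'M[F]_n) (Sm : 'M[F]_(m, n))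
    (Rm : 'M[F]_m) (x : 'cV[F]_n) (u : 'cV[F]_m) :
  sym_mx Rm -> (forall w : 'cV[F]_m, Rm *m w = 0 -> Sm^T *m w = 0) ->
  qf (block_mx Qm Sm^T Sm Rm) (col_mx x u) =
  qf (Qm - Sm^T *m mpinv Rm *m Sm) x + qf Rm (u + mpinv Rm *m Sm *m x).
Proof.
move=> sR kRS; set Y := _ - _; set K := mpinv Rm *m Sm.
have sX := mpinv_sym sR; have SXR := mpinv_ker kRS.
have KR : K^T *m Rm = Sm^T by rewrite trmx_mul sX -mulmxA.
have RK : Rm *m K = Sm by rewrite -[LHS]trmxK trmx_mul sR KR trmxK.
have -> : block_mx Qm Sm^T Sm Rm =
    (block_mx 1%:M 0 K 1%:M)^T *m block_mx Y 0 0 Rm *m block_mx 1%:M 0 K 1%:M.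
  rewrite tr_block_mx !mulmx_block !trmx1 !trmx0.
  rewrite !(mul0mx, mulmx0, mul1mx, mulmx1, addr0, add0r) KR RK.
  by rewrite /K mulmxA subrK.
rewrite /qf bil_congr mul_block_col !mul1mx mul0mx addr0 (addrC (K *m x)).
rewrite /bil tr_col_mx mul_row_block !mulmx0 addr0 add0r mul_row_col.
by rewrite mxE.
Qed.

(** * The Riccati step as a Bellman operator *)

Section RiccatiStep.
Variables (F : realFieldType) (nx nu : nat).
Variables (A : 'M[F]_nx) (B : 'M[F]_(nx, nu)).
Variables (Q : 'M[F]_nx) (S : 'M[F]_(nu, nx)) (R : 'M[F]_nu).
Hypothesis symH : sym_mx (block_mx Q S^T S R).

Local Notation H := (block_mx Q S^T S R).
Local Notation HM := (Hof A B Q S R).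
Local Notation RM := (Rof B R).
Local Notation SM := (Sof A B S).
Local Notation KM := (Kof A B S R).

(** Generalized Schur complement of [RM M] in [HM M], and also the residual of the Riccati equation
    at [M]. *)
Definition schur (M : 'M[F]_nx) : 'M[F]_nx :=
  Qof A Q M - (SM M)^T *m mpinv (RM M) *m SM M.

(* The value iteration (Riccati difference) operator. *)
Definition riccati_step (M : 'M[F]_nx) : 'M[F]_nx := M + schur M.

Definition feasible (M : 'M[F]_nx) : Prop := sym_mx M /\ psd_mx (HM M).

Lemma symQR : sym_mx Q /\ sym_mx R.
Proof.
by move: symH; rewrite /sym_mx tr_block_mx => /eq_block_mx[-> _ _ ->].
Qed.

Lemma sym_Qof M : sym_mx M -> sym_mx (Qof A Q M).
Proof.
move=> sM; apply: symB => //; apply: symD; first exact: symQR.1.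
exact: sym_congr.
Qed.

Lemma sym_Rof M : sym_mx M -> sym_mx (RM M).
Proof. by move=> sM; apply: symD; [exact: symQR.2 | exact: sym_congr]. Qed.

Lemma sym_Hof M : sym_mx M -> sym_mx (HM M).
Proof.
by move=> sM; rewrite /sym_mx tr_block_mx trmxK sym_Qof ?sym_Rof.
Qed.

Lemma sym_schur M : sym_mx M -> sym_mx (schur M).
Proof.
move=> sM; apply: symB; first exact: sym_Qof.
by apply: sym_congr; apply/mpinv_sym/sym_Rof.
Qed.

(** [HM M] is [H] plus two congruences of [M], by [row_mx A B] and by the projection on the state.
    The bilinear version allows two different trajectories to be paired. *)
Lemma bil_Hof M x u y w : sym_mx M ->
  bil (HM M) (col_mx x u) (col_mx y w) =
  bil H (col_mx x u) (col_mx y w)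
  + bil M (A *m x + B *m u) (A *m y + B *m w) - bil M x y.
Proof.
move=> sM.
have -> : HM M = H + (row_mx A B)^T *m M *m row_mx A B
                 - (row_mx 1%:M 0)^T *m M *m row_mx 1%:M 0.
  rewrite !tr_row_mx ![col_mx _ _ *m M]mul_col_mx !mul_col_row.
  rewrite opp_block_mx !add_block_mx.
  rewrite trmx1 trmx0 !(mul0mx, mulmx0, mul1mx, mulmx1, oppr0, addr0).
  by rewrite /Hof /Sof linearD /= !trmx_mul trmxK sM !mulmxA.
by rewrite bilB bilD !bil_congr !mul_row_col !mul1mx !mul0mx !addr0.
Qed.

Lemma qf_Hof M x u : sym_mx M ->
  qf (HM M) (col_mx x u) =
  qf H (col_mx x u) + qf M (A *m x + B *m u) - qf M x.
Proof. exact: bil_Hof. Qed.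

Lemma psd_Rof M : feasible M -> psd_mx (RM M).
Proof.
case=> sM [_ pH]; split; first exact: sym_Rof.
move=> u; have := pH (col_mx 0 u).
rewrite tr_col_mx mul_row_block trmx0 !mul0mx !add0r mul_row_col mulmx0.
by rewrite add0r.
Qed.

(** Such a [u] makes the form of [HM M] vanish at [col_mx 0 u], so semi-definiteness puts this
    vector in the kernel of [HM M]; the upper block is the claim. *)
Lemma feasible_ker M : feasible M ->
  forall u : 'cV[F]_nu, RM M *m u = 0 -> (SM M)^T *m u = 0.
Proof.
case=> sM pH u Ru0; have : HM M *m col_mx 0 u = 0.
  apply: psd_mulmx0 => //; rewrite /qf /bil -mulmxA mul_block_col Ru0.
  by rewrite tr_col_mx mul_row_col trmx0 mul0mx mulmx0 !add0r mulmx0 mxE.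
rewrite mul_block_col Ru0 !mulmx0 add0r addr0 -(col_mx0 _ _ _ 1).
by case/eq_col_mx.
Qed.

Lemma qf_Hof_square M x u : feasible M ->
  qf (HM M) (col_mx x u) = qf (schur M) x + qf (RM M) (u + KM M *m x).
Proof.
move=> fM; apply: complete_square; first exact/sym_Rof/fM.1.
exact: feasible_ker.
Qed.

Lemma qf_schur_le M x u : feasible M ->
  qf (schur M) x <= qf (HM M) (col_mx x u).
Proof.
by move=> fM; rewrite qf_Hof_square // lerDl; exact: (psd_Rof fM).2.
Qed.

Lemma qf_schur_attained M x : feasible M ->
  qf (schur M) x = qf (HM M) (col_mx x (- (KM M *m x))).
Proof.
by move=> fM; rewrite qf_Hof_square // addNr [qf _ 0]bil0l addr0.
Qed.

Lemma psd_schur M : feasible M -> psd_mx (schur M).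
Proof.
move=> fM; split; first exact/sym_schur/fM.1.
by move=> x; rewrite -/(bil _ _ _) -/(qf _ _) qf_schur_attained //; apply fM.2.
Qed.

Lemma qf_step M x : qf (riccati_step M) x = qf M x + qf (schur M) x.
Proof. exact: bilD. Qed.

(** With [qf_step_attained], this is the Bellman equation: the step is the optimal one-stage cost
    with terminal cost [M]. *)
Lemma qf_step_le M x u : feasible M ->
  qf (riccati_step M) x <= qf H (col_mx x u) + qf M (A *m x + B *m u).
Proof.
move=> fM; have := qf_schur_le x u fM; rewrite qf_Hof; last exact: fM.1.
by rewrite qf_step; lra.
Qed.

Lemma qf_step_attained M x : feasible M ->
  exists u, qf (riccati_step M) x =
            qf H (col_mx x u) + qf M (A *m x + B *m u).
Proof.
move=> fM; have := qf_schur_attained x fM; rewrite qf_Hof; last exact: fM.1.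
exists (- (KM M *m x)).
by rewrite qf_step; lra.
Qed.

Lemma qf_step_ge M x : feasible M -> qf M x <= qf (riccati_step M) x.
Proof.
move=> fM; rewrite qf_step lerDl.
exact: (psd_schur fM).2.
Qed.

Lemma psd_HofI M : sym_mx M ->
  (forall x u, qf M x <= qf H (col_mx x u) + qf M (A *m x + B *m u)) ->
  feasible M.
Proof.
move=> sM leM; split=> //; split; first exact: sym_Hof.
move=> z; rewrite -/(bil _ _ _) -/(qf _ _) -[z]vsubmxK qf_Hof // subr_ge0.
exact: leM.
Qed.

(** In the Bellman inequality, the terminal cost [M] may be raised to [riccati_step M], which
    dominates it. *)
Lemma feasible_step M : feasible M -> feasible (riccati_step M).
Proof.
move=> fM; apply: psd_HofI => [|x u].
  by apply: symD; [exact: fM.1 | exact/sym_schur/fM.1].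
by apply: (le_trans (qf_step_le x u fM)); rewrite lerD2l qf_step_ge.
Qed.

Lemma feasible_iter M k : feasible M -> feasible (iter k riccati_step M).
Proof. by move=> fM; elim: k => //= k; exact: feasible_step. Qed.

Lemma condII_condI : condII A B Q S R -> condI A B Q S R.
Proof.
case=> L [sL pL dL]; have fL : feasible L by [].
have [sT pT] := feasible_step fL.
by exists (riccati_step L), L; split=> //; rewrite /riccati_step addrC addKr.
Qed.

End RiccatiStep.

(** * Exponential stability in terms of squared norms *)

Lemma small_expr (F : realType) (r e : F) :
  0 < r -> r < 1 -> 0 < e -> exists N, r ^+ N.+1 < e.
Proof.
move=> r0 r1 e0; have r1' : `|r| < 1 by rewrite gtr0_norm.
have /cvgr_lt/(_ _ e0)[N _ NP] := cvg_expr r1'.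
by exists N; apply: NP => /=; apply: leqnSn.
Qed.

Lemma enormE (F : realType) n (x : 'cV[F]_n) : enorm x = Num.sqrt (qf 1%:M x).
Proof. by rewrite qf1E. Qed.

(** Squaring both constants removes the square roots, so that stability becomes a statement about
    quadratic forms. *)
Lemma exp_stableP (F : realType) n m (M : 'M[F]_n) (N : 'M[F]_(n, m)) :
  exp_stable M N <->
  exists C r : F, [/\ 0 < C, 0 < r, r < 1 &
    forall (x : nat -> 'cV[F]_n) (v : nat -> 'cV[F]_m),
      (forall k, x k.+1 = M *m x k + N *m v k) ->
      forall k, qf 1%:M (x k) <= C * r ^+ k * qf 1%:M (x 0%N)].
Proof.
split=> [[c [r [c0 r0 r1 h]]]|[C [r [C0 r0 r1 h]]]].
  exists (c ^+ 2), (r ^+ 2); rewrite !exprn_gt0 ?exprn_ilt1 ?(ltW r0) //.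
  split=> // x v xv k; have := h x v xv k.
  rewrite !enormE -ler_sqr ?nnegrE ?mulr_ge0 ?exprn_ge0 ?sqrtr_ge0
    ?(ltW c0) ?(ltW r0) //.
  by rewrite !exprMn !sqr_sqrtr ?qf1_ge0 // exprAC.
exists (Num.sqrt C), (Num.sqrt r); rewrite !sqrtr_gt0; split=> //.
  by rewrite -sqrtr1 ltr_sqrt.
move=> x v xv k; have := h x v xv k.
rewrite !enormE -(@ler_sqrt _ (qf _ (x k))); last first.
  by rewrite !mulr_ge0 ?exprn_ge0 ?qf1_ge0 ?ltW.
rewrite !sqrtrM ?mulr_ge0 ?exprn_ge0 ?(ltW C0) ?(ltW r0) //.
rewrite -[in X in _ * X * _](sqr_sqrtr (ltW r0)) exprAC sqrtr_sqr ger0_norm //.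
by rewrite exprn_ge0 ?sqrtr_ge0.
Qed.

Lemma stabilizableP (F : realType) nx nu (A : 'M[F]_nx) (B : 'M[F]_(nx, nu)) :
  stabilizable A B ->
  exists (Fb : 'M[F]_(nu, nx)) (C r : F), [/\ 0 < C, 0 < r, r < 1 &
    forall x k, qf 1%:M (iter k (mulmx (A - B *m Fb)) x)
                <= C * r ^+ k * qf 1%:M x].
Proof.
case=> Fb /exp_stableP[C [r [C0 r0 r1 h]]]; exists Fb, C, r; split=> // x k.
apply: (h (fun k => iter k _ x) (fun=> 0)) => {}k.
by rewrite mulmx0 addr0.
Qed.

(** * From two ordered certificates to a strict one *)

Section ValueIteration.
Variables (F : realType) (nx nu : nat).
Variables (A : 'M[F]_nx) (B : 'M[F]_(nx, nu)).
Variables (Q : 'M[F]_nx) (S : 'M[F]_(nu, nx)) (R : 'M[F]_nu).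
Hypothesis symH : sym_mx (block_mx Q S^T S R).

Local Notation H := (block_mx Q S^T S R).
Local Notation HM := (Hof A B Q S R).
Local Notation step := (riccati_step A B Q S R).
Local Notation schur := (schur A B Q S R).
Local Notation feasible := (feasible A B Q S R).

(** Dynamic programming: the gain of [N] steps is the total [HM L] cost of an optimal trajectory. *)
Lemma iter_step_trajectory L N x : feasible L ->
  exists (xs : nat -> 'cV[F]_nx) (us : nat -> 'cV[F]_nu),
    [/\ xs 0%N = x, forall k, xs k.+1 = A *m xs k + B *m us k &
        qf (iter N step L) x - qf L x =
        \sum_(k < N) qf (HM L) (col_mx (xs k) (us k))].
Proof.
move=> fL; elim: N x => [|N IH] x.
  exists (fun k => iter k (mulmx A) x), (fun=> 0); split=> // [k|].
    by rewrite mulmx0 addr0.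
  by rewrite subrr big_ord0.
(* With [N.+1] stages to go, the first input minimizes against the value with [N] stages to go; the
   induction hypothesis continues from the successor. *)
have [u eu] := qf_step_attained symH x (feasible_iter symH N fL).
have [xs [us [xs0 xsS e]]] := IH (A *m x + B *m u).
exists (fun k => if k is k'.+1 then xs k' else x).
exists (fun k => if k is k'.+1 then us k' else u); split=> // [[|k] //|].
rewrite big_ord_recl /= -e eu qf_Hof //; last exact: fL.1.
by ring.
Qed.

Lemma condI_condII :
  stabilizable A B -> condI A B Q S R -> condII A B Q S R.
Proof.
move=> /stabilizableP[Fb [C [r [C0 r0 r1 stab]]]].
case=> L1 [L2 [s1 s2 p1 p2 pD]]; pose D := L1 - L2.
pose L := 2^-1 *: (L1 + L2).
have sL : sym_mx L by exact/symZ/symD.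
have qL x u : qf (HM L) (col_mx x u) =
    2^-1 * (qf (HM L1) (col_mx x u) + qf (HM L2) (col_mx x u)).
  by rewrite !qf_Hof // /L /qf !bilZ !bilD; field.
have q1 x u : 0 <= qf (HM L1) (col_mx x u) by exact: p1.2.
have q2 x u : 0 <= qf (HM L2) (col_mx x u) by exact: p2.2.
have fL : feasible L.
  apply: psd_HofI => // x u; rewrite -subr_ge0 -qf_Hof // qL.
  by rewrite mulr_ge0 ?invr_ge0 ?addr_ge0.
have [e e0 De] := pd_lb pD; have [Cd Cd0 DC] := qf_ub D.
have CC0 : 0 < Cd * C by rewrite mulr_gt0.
(* This horizon makes [qf D] of the stabilized trajectory fall below [qf D x], for every nonzero [x]
   at once. *)
have [N Nsmall] := small_expr r0 r1 (divr_gt0 e0 CC0).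
have incr x : x != 0 -> qf L x < qf (iter N.+1 step L) x.
  move=> xN0; rewrite ltNge; apply/negP => le0.
  have [xs [us [xs0 xsS ecost]]] := iter_step_trajectory N.+1 x fL.
  have zero k : (k < N.+1)%N -> qf (HM L) (col_mx (xs k) (us k)) = 0.
    move=> kN; have : \sum_(k < N.+1) qf (HM L) (col_mx (xs k) (us k)) == 0.
      rewrite eq_le -{1}ecost subr_le0 le0 sumr_ge0 // => i _.
      exact: fL.2.2.
    rewrite psumr_eq0 => [/allP/(_ (Ordinal kN))|i _]; last exact: fL.2.2.
    by rewrite mem_index_enum => /(_ isT)/eqP.
  (* Both costs are nonnegative with zero sum, so both vanish, and each null vector is orthogonal to
     all [col_mx y w]. Subtracting the two identities cancels [H]. *)
  have shift k y w : (k < N.+1)%N ->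
      bil D (xs k.+1) (A *m y + B *m w) = bil D (xs k) y.
    move=> kN; have := zero k kN; rewrite qL => z0.
    have z1 : qf (HM L1) (col_mx (xs k) (us k)) = 0.
      by have := q1 (xs k) (us k); have := q2 (xs k) (us k); lra.
    have z2 : qf (HM L2) (col_mx (xs k) (us k)) = 0.
      by have := q1 (xs k) (us k); have := q2 (xs k) (us k); lra.
    have := psd_qf0_bil0 (col_mx y w) p1 z1.
    have := psd_qf0_bil0 (col_mx y w) p2 z2.
    by rewrite !bil_Hof // -xsS /D !bilB; lra.
  pose y k := iter k (mulmx (A - B *m Fb)) x.
  have yS k : y k.+1 = A *m y k + B *m (- (Fb *m y k)).
    by rewrite /y /= mulmxBl mulmxN mulmxA.
  have Dxy k : (k <= N.+1)%N -> bil D (xs k) (y k) = qf D x.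
    elim: k => [|k IH] kN; first by rewrite xs0.
    by rewrite yS shift // IH // ltnW.
  have Dxx k : (k <= N.+1)%N -> qf D (xs k) = qf D x.
    elim: k => [|k IH] kN; first by rewrite xs0.
    by rewrite /qf {2}xsS shift // [LHS]IH // ltnW.
  have x0 : 0 < qf D x by exact: pD.2.
  (* Cauchy-Schwarz for [D] now reads [qf D x ^+ 2 <= qf D x * qf D (y N.+1)], against the choice of
     [N]. *)
  have := psd_bil_sqr_le (xs N.+1) (y N.+1) (pd_psd pD).
  rewrite Dxy // Dxx // expr2 ler_pM2l // leNgt => /negP; apply.
  apply: (le_lt_trans (DC _)); apply: (lt_le_trans _ (De x)).
  apply: (@le_lt_trans _ _ (Cd * (C * r ^+ N.+1 * qf 1%:M x))).
    by rewrite ler_pM2l // stab.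
  rewrite !mulrA ltr_pM2r; last first.
    have := le_lt_trans (le_refl _) (lt_le_trans x0 (DC x)).
    by rewrite pmulr_rgt0.
  by rewrite mulrC -ltr_pdivlMr.
pose Lk k := iter k step L.
have fLk k : feasible (Lk k) by exact: feasible_iter.
pose M := N.+1%:R^-1 *: \sum_(k < N.+1) Lk k.
have N0 : 0 < N.+1%:R^-1 :> F by rewrite invr_gt0 ltr0Sn.
have sM : sym_mx M by apply/symZ/sym_sum => k; exact: (fLk k).1.
have qM x u : qf (HM M) (col_mx x u) =
    N.+1%:R^-1 * \sum_(k < N.+1) qf (HM (Lk k)) (col_mx x u).
  rewrite qf_Hof // /M /qf !bilZ !bil_sum.
  have -> : \sum_(k < N.+1) bil (HM (Lk k)) (col_mx x u) (col_mx x u) =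
      \sum_(k < N.+1) (bil H (col_mx x u) (col_mx x u)
        + (bil (Lk k) (A *m x + B *m u) (A *m x + B *m u)
        - bil (Lk k) x x)).
    by apply: eq_bigr => k _; rewrite addrA; apply/qf_Hof/(fLk k).1.
  rewrite big_split /= sumrB sumr_const card_ord -[bil H _ _ *+ _]mulr_natr.
  have : N.+1%:R != 0 :> F by rewrite pnatr_eq0.
  by move: (N.+1%:R) => c c0; field.
have fM : feasible M.
  apply: psd_HofI => // x u; rewrite -subr_ge0 -qf_Hof // qM.
  apply: mulr_ge0; first exact: ltW.
  by apply: sumr_ge0 => k _; exact: (fLk k).2.2.
exists M; split; [exact: sM | exact: fM.2 |].
split=> [|x xN0]; first exact: sym_schur.
rewrite -/(schur M) -/(bil _ _ _) -/(qf _ _) qf_schur_attained // qM.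
rewrite pmulr_rgt0 //.
(* The minimizer for the average is one candidate input for each [Lk k]; the sum of the separate
   minima then telescopes to the total gain. *)
apply: (@lt_le_trans _ _ (\sum_(k < N.+1) qf (schur (Lk k)) x)); last first.
  by apply: ler_sum => k _; exact: qf_schur_le.
have -> : \sum_(k < N.+1) qf (schur (Lk k)) x =
    \sum_(0 <= k < N.+1) (qf (Lk k.+1) x - qf (Lk k) x).
  rewrite big_mkord; apply: eq_bigr => k _.
  by rewrite [Lk k.+1]iterS qf_step addrC addKr.
by rewrite telescope_sumr // subr_gt0 incr.
Qed.

End ValueIteration.

(** * Monotone limits of forms and Lyapunov functions *)

Lemma le_eps (F : realFieldType) (a b c : F) :
  0 <= c -> (forall e, 0 < e -> a <= b + e * c) -> a <= b.
Proof.
move=> c0 H; apply/ler_addgt0Pr => e e0.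
have c1 : 0 < 1 + c by rewrite ltr_pwDl.
apply: (le_trans (H _ (divr_gt0 e0 c1))); rewrite lerD2l.
by rewrite mulrAC ler_pdivrMr // ler_pM2l // lerDr.
Qed.

(** Monotone convergence for each [x], carried to the entries by polarization. In the last clause
    one index serves all [x], since only finitely many entries have to converge. *)
Lemma psd_monotone_limit (F : realType) n (L : nat -> 'M[F]_n) :
  (forall k, sym_mx (L k)) ->
  (forall k x, qf (L k) x <= qf (L k.+1) x) ->
  (forall x, exists b, forall k, qf (L k) x <= b) ->
  exists P, [/\ sym_mx P, forall k x, qf (L k) x <= qf P x &
    forall e, 0 < e -> exists k, forall x,
      qf P x <= qf (L k) x + e * qf 1%:M x].
Proof.
move=> sL incL bL.
have homoL x : {homo (fun k => qf (L k) x) : k l / (k <= l)%N >-> k <= l}.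
  apply: homo_leq => [//|? ? ?|k]; [exact: le_trans | exact: incL].
have cvL x : cvgn (fun k => qf (L k) x).
  apply: nondecreasing_is_cvgn; first exact: homoL.
  by have [b bP] := bL x; exists b => _ [k _ <-].
pose p x := limn (fun k => qf (L k) x).
pose P := \matrix_(i, j) ((p (delta_mx i 0 + delta_mx j 0)
           - p (delta_mx i 0) - p (delta_mx j 0)) / 2 : F).
have cvP i j : (fun k => L k i j) @ \oo --> P i j.
  have -> : (fun k => L k i j) = (fun k =>
      (qf (L k) (delta_mx i 0 + delta_mx j 0)
       - qf (L k) (delta_mx i 0) - qf (L k) (delta_mx j 0)) / 2).
    by apply/funext => k; exact: sym_entry.
  by rewrite mxE; apply: cvgMr_tmp; apply: cvgB; [apply: cvgB|]; exact: cvL.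
have cvq x : (fun k => qf (L k) x) @ \oo --> qf P x.
  rewrite /qf bilE; under eq_fun do rewrite bilE.
  apply: cvg_big => [|i _]; first exact: add_continuous.
  apply: cvg_big => [|j _]; first exact: add_continuous.
  by apply: cvgMr_tmp; apply: cvgMl_tmp; exact: cvP.
exists P; split=> [|k x|e e0].
- by apply/matrixP => i j; rewrite !mxE [delta_mx j 0 + _]addrC addrAC.
- rewrite -(cvg_lim _ (cvq x)) //.
  by apply: (nondecreasing_cvgn_le (homoL x)).
(* The limit 0 is first written as the norm sum of [P - P], the shape that termwise convergence
   produces. *)
- have sum0 : \sum_(i < n) \sum_(j < n) `|P i j - P i j| = 0.
    by rewrite big1 // => i _; rewrite big1 // => j _; rewrite subrr normr0.
  have : (fun k => \sum_i \sum_j `|(P - L k) i j|) @ \oo -->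
      \sum_(i < n) \sum_(j < n) `|P i j - P i j|.
    apply: cvg_big => [|i _]; first exact: add_continuous.
    apply: cvg_big => [|j _]; first exact: add_continuous.
    under eq_fun do rewrite mxE [X in _ + X]mxE.
    apply: (@cvg_norm _ _ _ _ _ (fun k => P i j - L k i j)).
    by apply: cvgB; [exact: cvg_cst | exact: cvP].
  rewrite sum0 => /cvgr_le/(_ _ e0)[k _ kP]; exists k => x.
  rewrite -lerBlDl -bilB; apply: (le_trans (qf_le_norm _ _)).
  by rewrite ler_wpM2r ?qf1_ge0 //; exact: (kP k (leqnn k)).
Qed.

(** The decrease is at least [e / C] times [qf V x], so [V] contracts by [1 - e / C] at each step,
    whatever the input. *)
Lemma lyapunov_exp_stable (F : realType) n m (M : 'M[F]_n) (N : 'M[F]_(n, m))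
    (V : 'M[F]_n) (e : F) :
  0 < e -> (forall x, e * qf 1%:M x <= qf V x) ->
  (forall x v, qf V (M *m x + N *m v) <= qf V x - e * qf 1%:M x) ->
  exp_stable M N.
Proof.
(* Adding [e] to the upper bound gives [e / C < 1], hence a positive rate. *)
move=> e0 Ve decV; have [C0 C0gt0 VC0] := qf_ub V; pose C := C0 + e.
have Cgt0 : 0 < C by rewrite addr_gt0.
have VC x : qf V x <= C * qf 1%:M x.
  by apply: (le_trans (VC0 x)); rewrite ler_wpM2r ?qf1_ge0 // lerDl ltW.
pose r := 1 - e / C.
have r0 : 0 < r by rewrite subr_gt0 ltr_pdivrMr // mul1r ltrDr.
have r1 : r < 1 by rewrite ltrBlDr ltrDl divr_gt0.
apply/exp_stableP; exists (C / e), r; split=> // [|x v xS k].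
  by rewrite divr_gt0.
have Vk : qf V (x k) <= r ^+ k * qf V (x 0%N).
  elim: k => [|k IH]; first by rewrite mul1r.
  rewrite xS exprS -mulrA; apply: (le_trans (decV _ _)).
  apply: (@le_trans _ _ (r * qf V (x k))); last by rewrite ler_pM2l.
  rewrite /r mulrBl mul1r lerD2l lerN2 mulrAC ler_pdivrMr // -mulrA.
  by rewrite ler_pM2l // mulrC.
rewrite -(ler_pM2l e0); apply: (le_trans (Ve _)); apply: (le_trans Vk).
rewrite [leRHS](_ : _ = r ^+ k * (C * qf 1%:M (x 0%N))); last first.
  by field; rewrite gt_eqF.
by rewrite ler_pM2l ?exprn_gt0.
Qed.

(** * A stabilizing solution as the limit of value iteration *)

Section Existence.
Variables (F : realType) (nx nu : nat).
Variables (A : 'M[F]_nx) (B : 'M[F]_(nx, nu)).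
Variables (Q : 'M[F]_nx) (S : 'M[F]_(nu, nx)) (R : 'M[F]_nu).
Hypothesis symH : sym_mx (block_mx Q S^T S R).

Local Notation HM := (Hof A B Q S R).
Local Notation RM := (Rof B R).
Local Notation KM := (Kof A B S R).
Local Notation step := (riccati_step A B Q S R).
Local Notation schur := (schur A B Q S R).
Local Notation feasible := (feasible A B Q S R).

Lemma iter_step_le L N (y : nat -> 'cV[F]_nx) (w : nat -> 'cV[F]_nu) :
  feasible L -> (forall k, y k.+1 = A *m y k + B *m w k) ->
  qf (iter N step L) (y 0%N) <=
  qf L (y 0%N) + \sum_(k < N) qf (HM L) (col_mx (y k) (w k)).
Proof.
move=> fL; elim: N y w => [|N IH] y w yS; first by rewrite big_ord0 addr0.
apply: (le_trans (qf_step_le symH _ (w 0%N) (feasible_iter symH N fL))).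
rewrite -yS big_ord_recl /= (@qf_Hof _ _ _ A B Q S R L) -?yS; last exact: fL.1.
have := IH (fun k => y k.+1) (fun k => w k.+1) (fun k => yS k.+1).
by rewrite /=; lra.
Qed.

Lemma iter_step_bounded L x : stabilizable A B -> feasible L ->
  exists b, forall k, qf (iter k step L) x <= b.
Proof.
move=> /stabilizableP[Fb [C [r [C0 r0 r1 stab]]]] fL.
(* Along the stabilizing feedback the stage cost is a quadratic form of the state alone, so its sum
   is bounded by a geometric series. *)
have [Ch Ch0 hC] :=
  qf_ub ((col_mx 1%:M (- Fb))^T *m HM L *m col_mx 1%:M (- Fb)).
exists (qf L x + Ch * C * qf 1%:M x / (1 - r)) => N.
pose y k := iter k (mulmx (A - B *m Fb)) x.
have yS k : y k.+1 = A *m y k + B *m (- (Fb *m y k)).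
  by rewrite /y /= mulmxBl mulmxN mulmxA.
apply: (le_trans (iter_step_le N fL yS)); rewrite lerD2l.
have r1' : 0 < 1 - r by rewrite subr_gt0.
rewrite ler_pdivlMr //.
apply: (@le_trans _ _ ((\sum_(k < N) Ch * (C * r ^+ k * qf 1%:M x)) * (1 - r))).
  rewrite ler_pM2r //; apply: ler_sum => k _.
  have -> : col_mx (y k) (- (Fb *m y k)) = col_mx 1%:M (- Fb) *m y k.
    by rewrite mul_col_mx mul1mx mulNmx.
  rewrite /qf -bil_congr; apply: (le_trans (hC _)).
  by rewrite ler_pM2l // stab.
rewrite -mulr_sumr -mulr_suml -mulr_sumr.
have := subrX1 r N; set s := \sum_(i < N) _ => es.
have -> : Ch * (C * s * qf 1%:M x) * (1 - r) =
    Ch * C * qf 1%:M x * (1 - r ^+ N).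
  by rewrite -[1 - r ^+ N]opprB es; ring.
rewrite ler_piMr ?mulr_ge0 ?qf1_ge0 ?(ltW C0) ?(ltW Ch0) //.
by rewrite lerBlDr lerDl exprn_ge0 // ltW.
Qed.

Lemma qf_Rof M u : qf (RM M) u = qf R u + qf M (B *m u).
Proof. by rewrite /qf bilD bil_congr. Qed.

Lemma condII_solution : stabilizable A B -> condII A B Q S R ->
  exists P : 'M[F]_nx,
    [/\ CGDARE A B Q S R P, closed_loop_exp_stable A B S R P &
        B *m Gof B R P = 0].
Proof.
move=> stabAB [L [sL pL pdL]]; have fL : feasible L by [].
have [e0 e00 schure] := pd_lb pdL.
pose Lk k := iter k step L.
have fLk k : feasible (Lk k) by exact: feasible_iter.
have incLk k x : qf (Lk k) x <= qf (Lk k.+1) x by exact: qf_step_ge.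
(* The sequence starts at the first iterate, which exceeds [L] by [schur L]; the limit inherits this
   margin. *)
have [||x|P [sP leP limP]] := @psd_monotone_limit _ _ (fun k => Lk k.+1).
- by move=> k; exact: (fLk k.+1).1.
- by move=> k x; exact: incLk.
- have [b bP] := iter_step_bounded x stabAB fL.
  by exists b => k; exact: bP.
have leLk k x : qf L x + qf (schur L) x <= qf (Lk k.+1) x.
  elim: k => [|k IH]; first by rewrite -qf_step.
  exact: (le_trans IH (incLk k.+1 x)).
have LP x : qf L x + e0 * qf 1%:M x <= qf P x.
  by apply: le_trans (leP 0%N x); apply: le_trans (leLk 0%N x); rewrite lerD2l.
have fP : feasible P.
  apply: psd_HofI => // x u; apply: (le_eps (qf1_ge0 x)) => e /limP[k kP].
  apply: (le_trans (kP x)); rewrite lerD2r.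
  apply: (le_trans (qf_step_le symH x u (fLk k))); rewrite lerD2l.
  exact: (le_trans (incLk _ _) (leP _ _)).
have schurP0 : schur P = 0.
  apply: psd_qf0 => [|x]; first exact: psd_schur.
  pose c := (qf P x - qf L x) / e0.
  have qx0 := qf1_ge0 x; have LPx := LP x.
  have c0 : 0 <= c.
    rewrite divr_ge0 ?(ltW e00) // subr_ge0; apply: le_trans LPx.
    by rewrite lerDl mulr_ge0 // ltW.
  apply: (le_eps c0) => e egt0; rewrite add0r; have [k kP] := limP e egt0.
  have [u eu] := qf_step_attained symH x (fLk k.+1).
  apply: (le_trans (qf_schur_le symH x u fP)); rewrite qf_Hof //.
  move: eu (kP (A *m x + B *m u)) (leP k.+1 x) => eu kPu lePx.
  have := fL.2.2 (col_mx x u); rewrite -/(bil _ _ _) -/(qf _ _) qf_Hof // => hL.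
  (* As the [HM L] cost is nonnegative, the excess of the iterate over [L] at the successor is at
     most [qf P x - qf L x]. This excess dominates [schur L], hence [e0] times the squared norm; the
     bound does not depend on [k]. *)
  have xb : qf 1%:M (A *m x + B *m u) <= c.
    rewrite /c ler_pdivlMr // mulrC.
    have := le_trans (schure _) (_ : qf (schur L) (A *m x + B *m u) <= _).
    apply; have := leLk k (A *m x + B *m u).
    by rewrite /Lk /= in eu lePx *; lra.
  have := ler_wpM2l (ltW egt0) xb.
  by rewrite /Lk /= in eu lePx kPu *; lra.
(* Columns of [Gof B R P] lie in the kernel of [RM P]. For such a [u], [qf (RM L) u] equals
   [qf L (B *m u) - qf P (B *m u)], which is negative unless [B *m u = 0]. *)
have BG : B *m Gof B R P = 0.
  apply/matrixP => i j; rewrite [RHS]mxE.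
  have [RXR _ _ _] := (mpinvP (RM P) (mpinv (RM P))).2 erefl.
  have Ru : RM P *m col j (Gof B R P) = 0.
    by rewrite colE mulmxA /Gof mulmxBr mulmx1 mulmxA RXR subrr mul0mx.
  have Bu : B *m col j (Gof B R P) = 0.
    move: (col j _) Ru => u Ru.
    have : qf (RM P) u = 0 by rewrite /qf /bil -mulmxA Ru mulmx0 mxE.
    have RL0 : 0 <= qf (RM L) u := (psd_Rof symH fL).2 u.
    move: RL0; rewrite !qf_Rof.
    have [//|BuN0] := eqVneq (B *m u) 0.
    have sBu : 0 < qf (schur L) (B *m u) := pdL.2 _ BuN0.
    have := leP 0%N (B *m u); have := leLk 0%N (B *m u) => ? ? ? ?.
    by exfalso; lra.
  by move: Bu; rewrite colE mulmxA -colE => /matrixP/(_ i 0); rewrite !mxE.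
exists P; split=> //.
  split=> //; first by rewrite /Kof mulmxA -schurP0.
  exact: (feasible_ker fP).
apply: (@lyapunov_exp_stable _ _ _ _ _ (P - L) e0) => // x.
  by rewrite qf_subm; have := LP x; lra.
move=> v; rewrite BG mul0mx addr0.
have -> : (A - B *m KM P) *m x = A *m x + B *m (- (KM P *m x)).
  by rewrite mulmxBl mulmxN -[in LHS]mulmxA.
(* At the input [- (KM P *m x)] the [HM P] cost is zero and the [HM L] cost is at least
   [e0 * qf 1%:M x]; their difference is the decrease of [P - L]. *)
have := qf_schur_attained symH x fP; rewrite schurP0 qf_Hof //.
have := qf_schur_le symH x (- (KM P *m x)) fL; rewrite qf_Hof //.
by have := schure x; rewrite -/(schur _) !qf_subm qf_mx0; lra.
Qed.

End Existence.

(** * Estimates for perturbing a stabilizing solution *)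

Lemma psd_qf1_mulmx (F : realFieldType) n (M : 'M[F]_n) (x : 'cV[F]_n) :
  psd_mx M -> qf 1%:M (M *m x) <= \tr M * qf M x.
Proof.
move=> pM; rewrite qf1E /mxtrace mulr_suml; apply: ler_sum => i _.
(* Cauchy-Schwarz against the unit vector [delta_mx i 0], whose form value is [M i i]. *)
rewrite -bil_deltal -[M i i]bil_delta; exact: psd_bil_sqr_le.
Qed.

(** Expand the nonnegative number [t^-1 * qf M (t *: a - b)]. *)
Lemma young_qf (F : realFieldType) n (M : 'M[F]_n) (t : F) (a b : 'cV[F]_n) :
  psd_mx M -> 0 < t ->
  qf M (a + b) <= (1 + t) * qf M a + (1 + t^-1) * qf M b.
Proof.
move=> pM t0; rewrite qfD; last exact: pM.1.
have : 0 <= t^-1 * qf M (t *: a - b).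
  by rewrite mulr_ge0 ?invr_ge0 ?(ltW t0) //; exact: pM.2.
rewrite qfD; last exact: pM.1.
rewrite -scaleN1r bilZl bilZr !qfZ.
suff -> : t^-1 * (t ^+ 2 * qf M a + 2 * (t * (-1 * bil M a b))
                  + (-1) ^+ 2 * qf M b)
          = t * qf M a - 2 * bil M a b + t^-1 * qf M b by lra.
by field; rewrite gt_eqF.
Qed.

(* The truncated sum [\sum_(k <= N) (M^k)^T M^k] already satisfies a strict
   Lyapunov inequality once [M^(N+1)] is small, so no limit is needed. *)
Lemma stable_lyapunov (F : realType) n (M : 'M[F]_n) (C r : F) :
  0 < C -> 0 < r -> r < 1 ->
  (forall x k, qf 1%:M (iter k (mulmx M) x) <= C * r ^+ k * qf 1%:M x) ->
  exists X, [/\ psd_mx X, forall x, qf 1%:M x <= qf X x &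
    forall x, qf X (M *m x) + 2^-1 * qf 1%:M x <= qf X x].
Proof.
move=> C0 r0 r1 stab.
have C20 : 0 < (2 * C)^-1 by rewrite invr_gt0 mulr_gt0.
have [N Nsmall] := small_expr r0 r1 C20.
pose pw k : 'M[F]_n := iter k (mulmx M) 1%:M.
have pwE k x : pw k *m x = iter k (mulmx M) x.
  by elim: k => [|k IH]; rewrite /pw ?mul1mx //= -mulmxA IH.
pose X := \sum_(k < N.+1) (pw k)^T *m 1%:M *m pw k.
have sX : sym_mx X.
  by apply: sym_sum => k; apply: sym_congr; exact: trmx1.
have qX x : qf X x = \sum_(0 <= k < N.+1) qf 1%:M (iter k (mulmx M) x).
  rewrite big_mkord /qf bil_sum; apply: eq_bigr => k _.
  by rewrite bil_congr pwE.
have qX1 x : qf 1%:M x <= qf X x.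
  rewrite qX big_nat_recl //= lerDl sumr_ge0 // => k _; exact: qf1_ge0.
exists X; split=> // [|x].
  by split=> // x; exact: le_trans (qf1_ge0 x) (qX1 x).
have -> : qf X (M *m x) =
    \sum_(0 <= k < N.+1) qf 1%:M (iter k.+1 (mulmx M) x).
  by rewrite qX; apply: eq_bigr => k _; rewrite iterSr.
rewrite -lerBrDl qX -sumrB.
under eq_bigr do rewrite -opprB.
rewrite sumrN (telescope_sumr (fun k => qf 1%:M (iter k (mulmx M) x))) //.
rewrite opprB /=.
have -> : 2^-1 * qf 1%:M x = qf 1%:M x - 2^-1 * qf 1%:M x by field.
rewrite lerD2l lerN2; apply: (le_trans (stab x N.+1)).
rewrite ler_wpM2r ?qf1_ge0 //.
by move: Nsmall; rewrite -[X in _ < X]mul1r ltr_pdivlMr ?mulr_gt0 //; lra.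
Qed.

(* Steering from the origin, where the stability bound vanishes, shows that
   the arbitrary input cannot act. *)
Lemma exp_stable_input0 (F : realType) n m (M : 'M[F]_n)
    (N : 'M[F]_(n, m)) :
  exp_stable M N -> N = 0.
Proof.
move=> /exp_stableP[C [r [_ _ _ stab]]]; apply/matrixP => i j.
pose w : 'cV[F]_m := delta_mx j 0.
have := stab (fun k => iter k (fun x => M *m x + N *m w) 0) (fun=> w)
  (fun=> erefl) 1%N.
rewrite /= mulmx0 add0r [qf _ 0]bil0l mulr0 /w -colE.
move=> /(le_trans (sqr_coord_le _ i)) N0; rewrite [RHS]mxE; apply/eqP.
by rewrite -sqrf_eq0 eq_le sqr_ge0 andbT; move: N0; rewrite !mxE.
Qed.

(** * From a stabilizing solution to a strict certificate *)

Section Necessity.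
Variables (F : realType) (nx nu : nat).
Variables (A : 'M[F]_nx) (B : 'M[F]_(nx, nu)).
Variables (Q : 'M[F]_nx) (S : 'M[F]_(nu, nx)) (R : 'M[F]_nu).
Hypothesis symH : sym_mx (block_mx Q S^T S R).

Local Notation HM := (Hof A B Q S R).
Local Notation RM := (Rof B R).
Local Notation KM := (Kof A B S R).
Local Notation schur := (schur A B Q S R).
Local Notation feasible := (feasible A B Q S R).

Lemma stable_condII P :
  CGDARE A B Q S R P -> psd_mx (RM P) -> closed_loop_exp_stable A B S R P ->
  condII A B Q S R.
Proof.
move=> [sP eP kP] pR clP.
have schurP0 : schur P = 0 by rewrite eP /Kof mulmxA.
have qHP x u : qf (HM P) (col_mx x u) = qf (RM P) (u + KM P *m x).
  rewrite complete_square //; last exact: pR.1.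
  by rewrite -/(schur P) schurP0 qf_mx0 add0r.
have BG := exp_stable_input0 clP.
pose Acl := A - B *m KM P.
have [C [r [C0 r0 r1 stab]]] : exists C r : F, [/\ 0 < C, 0 < r, r < 1 &
    forall x k, qf 1%:M (iter k (mulmx Acl) x) <= C * r ^+ k * qf 1%:M x].
  move/exp_stableP: clP => [C [r [C0 r0 r1 h]]]; exists C, r; split=> // x k.
  by apply: (h (fun k => iter k _ x) (fun=> 0)) => l; rewrite mulmx0 addr0.
have [X [pX X1 Xdec]] := stable_lyapunov C0 r0 r1 stab.
have [Ca Ca0 XCa] := qf_ub (Acl^T *m X *m Acl).
pose BX := B *m mpinv (RM P).
have [C2 C20 XC2] := qf_ub (BX^T *m X *m BX).
have tr0 : 0 <= \tr (RM P).
  by apply: sumr_ge0 => i _; rewrite -bil_delta; exact: pR.2.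
pose Cb := C2 * (1 + \tr (RM P)).
have Cb0 : 0 < Cb by rewrite mulr_gt0 // ltr_pwDl.
(* From [B *m Gof B R P = 0], the input acts only through [RM P *m w], whose norm is controlled by
   the cost [qf (RM P) w]. *)
have XCb w : qf X (B *m w) <= Cb * qf (RM P) w.
  have -> : B *m w = BX *m (RM P *m w).
    move/eqP: BG; rewrite /Gof mulmxBr mulmx1 subr_eq0 => /eqP {1}->.
    by rewrite /BX !mulmxA.
  rewrite /qf -bil_congr; apply: (le_trans (XC2 _)).
  rewrite /Cb -mulrA ler_pM2l //; apply: (le_trans (psd_qf1_mulmx w pR)).
  by rewrite ler_wpM2r ?lerDr //; exact: pR.2.
(* With this [t] the Young inequality spends a quarter of [qf 1%:M x], half of the decrease of [X];
   [eps] then lets [qf (RM P) w] absorb the input term. *)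
pose t := (4 * Ca)^-1.
have t0 : 0 < t by rewrite invr_gt0 mulr_gt0.
have tCb0 : 0 < (1 + t^-1) * Cb by rewrite mulr_gt0 // addr_gt0 // invr_gt0.
pose eps := ((1 + t^-1) * Cb)^-1.
have eps0 : 0 < eps by rewrite invr_gt0.
pose L := P - eps *: X.
have sL : sym_mx L by apply: symB => //; apply/symZ/pX.1.
(* This single bound, uniform in [u], yields both feasibility of [L] and definiteness of
   [schur L]. *)
have cost x u : eps / 4 * qf 1%:M x <= qf (HM L) (col_mx x u).
  pose w := u + KM P *m x.
  have next : A *m x + B *m u = Acl *m x + B *m w.
    rewrite /Acl /w mulmxBl -(mulmxA B) mulmxDr.
    by rewrite [B *m u + _]addrC addrA subrK.
  have -> : qf (HM L) (col_mx x u) =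
      qf (RM P) w + eps * (qf X x - qf X (A *m x + B *m u)).
    by rewrite -qHP !qf_Hof // /L !qf_subm /qf !bilZ; ring.
  rewrite next.
  have hy := young_qf (Acl *m x) (B *m w) pX t0.
  have ha : t * qf X (Acl *m x) <= 4^-1 * qf 1%:M x.
    have -> : 4^-1 * qf 1%:M x = t * (Ca * qf 1%:M x).
      by rewrite /t; field; rewrite gt_eqF.
    by rewrite ler_pM2l // /qf -bil_congr; exact: XCa.
  have hb : eps * ((1 + t^-1) * qf X (B *m w)) <= qf (RM P) w.
    have -> : qf (RM P) w = eps * ((1 + t^-1) * (Cb * qf (RM P) w)).
      by rewrite /eps [_ * (Cb * _)]mulrA mulKf // gt_eqF.
    by rewrite ler_pM2l // ler_pM2l ?XCb // addr_gt0 // invr_gt0.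
  have hd := Xdec x.
  have : eps * (4^-1 * qf 1%:M x) <= eps * (qf X x - qf X (Acl *m x + B *m w)
             + (1 + t^-1) * qf X (B *m w)).
    by rewrite ler_pM2l //; lra.
  by rewrite mulrDr; lra.
have fL : feasible L.
  apply: psd_HofI => // x u; rewrite -subr_ge0 -qf_Hof //.
  by apply: le_trans (cost x u); rewrite mulr_ge0 ?qf1_ge0 // divr_ge0 // ltW.
exists L; split; [exact: sL | exact: fL.2 |].
split=> [|x xN0]; first exact: sym_schur.
change (0 < qf (schur L) x); rewrite qf_schur_attained //.
apply: (lt_le_trans _ (cost x _)); rewrite pmulr_rgt0 ?divr_gt0 //.
rewrite lt_neqAle qf1_ge0 andbT eq_sym; apply: contra xN0 => /eqP x0.
apply/eqP/colP => i; apply/eqP; rewrite mxE -sqrf_eq0 eq_le sqr_ge0 andbT.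
by rewrite -x0 sqr_coord_le.
Qed.

End Necessity.

Theorem theorem4p10 (F : realType) (nx nu : nat)
    (A : 'M[F]_nx) (B : 'M[F]_(nx, nu))
    (Q : 'M[F]_nx) (S : 'M[F]_(nu, nx)) (R : 'M[F]_nu)
    (stabAB : stabilizable A B)
    (symH : sym_mx (block_mx Q S^T S R)) :
  (condI A B Q S R <-> condII A B Q S R) /\
  (condI A B Q S R \/ condII A B Q S R ->
     exists P : 'M[F]_nx,
       [/\ CGDARE A B Q S R P,
           closed_loop_exp_stable A B S R P &
           B *m Gof B R P = 0]) /\
  (forall P : 'M[F]_nx,
     CGDARE A B Q S R P -> psd_mx (Rof B R P) ->
     closed_loop_exp_stable A B S R P ->
     condI A B Q S R /\ condII A B Q S R).
Proof.
have I_II := condI_condII symH stabAB.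
split; first by split=> [/I_II|/(condII_condI symH)].
split=> [[/I_II|] cII|P eP pR clP]; [exact: condII_solution..|].
have cII := stable_condII symH eP pR clP.
by split=> //; exact: condII_condI.
Qed.
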